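(* There exists a set $S \subseteq \mathbb{Z}^+$ that, for each nonconstant polynomial $P$ with integer coefficients, contains one element of $P(\mathbb{Z}) \cap \mathbb{Z}^+$ and excludes one element of $P(\mathbb{Z}) \cap \mathbb{Z}^+$. Neither this set $S$ nor its complement contains all values of $P(\mathbb{Z}) \cap \mathbb{Z}^+$ for any $P \in \mathbb{Z}[x]$, yet at least one of $S$ and its complement is a ladder. Consequently, the converse of the following statement is not always true: if $P$ is some polynomial with integer coefficients such that $P(0)=0$, and a set $T$ contains $P(\mathbb{Z}) \cap \mathbb{Z}^+$, then $T$ is a ladder.
   Context: $\mathbb{Z}^+$ denotes the set of positive integers, $P(\mathbb{Z}) = \{P(n) : n \in \mathbb{Z}\}$, and the complement of $S$ is $\mathbb{Z}^+ \setminus S$. A set $T \subseteq \mathbb{Z}^+$ is a ladder if every coloring of $\mathbb{Z}$ with finitely many colors contains arbitrarily long (finite) monochromatic arithmetic progressions whose common difference lies in $T$.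
   Formalization: All three claims (S contains and excludes a value, neither S nor its complement contains all values, the converse fails) are stated only for P with P(Z)∩Z⁺ infinite; as written they fail, e.g. for P = −x²−1, which has no positive values, and for P = 0. *)

(* Defs.v *)
From HB Require Import structures.
From mathcomp Require Import all_boot all_order all_algebra.
From mathcomp Require Import boolp classical_sets functions cardinality.

Set Implicit Arguments.
Unset Strict Implicit.
Unset Printing Implicit Defensive.

Import Order.TTheory GRing.Theory Num.Theory.
Local Open Scope classical_set_scope.
Local Open Scope ring_scope.

Definition posint : set int := [set n | 0 < n].

(* [P(Z) ∩ Z^+].  For a non-zero [P], even a non-constant one, this set may be
   empty ([- 'X^2]) or finite ([1 - 'X^2]); statements about sets that contain
   or meet it are meaningful only under [infinite_set (pos_values P)]. *)
Definition pos_values (P : {poly int}) : set int :=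
  range (fun n : int => P.[n]) `&` posint.

(* [r] colors are given by ['I_r]; the progression [a, a + d, ...] has [k]
   terms. *)
Definition is_ladder (T : set int) : Prop :=
  T `<=` posint /\
  forall (r : nat) (chi : int -> 'I_r) (k : nat),
  exists a d : int, T d /\
  exists c : 'I_r, forall i : nat, (i < k)%N -> chi (a + d *+ i) = c.

(* Main.v *)
Require Import Defs.
From HB Require Import structures.
From mathcomp Require Import all_boot all_order all_algebra.
From mathcomp Require Import boolp classical_sets functions cardinality.
From mathcomp Require Import zify.

Set Implicit Arguments.
Unset Strict Implicit.
Unset Printing Implicit Defensive.

Import Order.TTheory GRing.Theory Num.Theory.
Local Open Scope classical_set_scope.
Local Open Scope ring_scope.

(** The ladder half is van der Waerden's theorem plus partition regularity:
    van der Waerden says that the set of all positive integers is a ladder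
    ([posint_ladder]), and if it is cut into two parts, neither of them a
    ladder, then the product of two bad colorings of the parts is bad for the
    whole ([ladder_setU]).  So for every set [S] of positive integers, [S] or
    its complement is a ladder, and [S] can be chosen freely.

    There are only countably many integer polynomials, so a diagonal
    construction gives a set [S] such that every infinite [pos_values P] meets
    both [S] and its complement ([splitting_set]).  Whichever of the two is a
    ladder contains no infinite [pos_values P], which refutes the converse.

    Van der Waerden's theorem ([van_der_waerden]) is proved by color focusing,
    by induction on the length of the progressions.  Given the theorem for one
    length, either the next length occurs, or one can build arbitrarily large
    fans ([fan_or_ap]): families of monochromatic progressions of pairwise
    different colors, all of which the same point would prolong.  But a fan has
    no more members than there are colors ([fan_size]). *)

(** * Van der Waerden's theorem *)

(** The progression has [k.+1] terms. *)
Definition mono_ap (C : Type) (chi : nat -> C) (k N : nat) : Prop :=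
  exists a d : nat, [/\ (0 < d)%N, (a + d * k < N)%N &
    forall i, (i <= k)%N -> chi (a + d * i)%N = chi a].

(** The [k.+1] terms start at [a + d].  The point [a] before them, of arbitrary
    color, is kept in range because it becomes the focus of a fan. *)
Definition pre_mono_ap (C : Type) (chi : nat -> C) (k N : nat) : Prop :=
  exists a d : nat, [/\ (0 < d)%N, (a + d * k.+1 < N)%N &
    forall i, (i <= k)%N -> chi (a + d * i.+1)%N = chi (a + d)%N].

(** A difference [d] stands for the progression of the points
    [f + d * i.+1] with [i <= k], aimed at the focus [f].  The difference [0] is
    allowed: it stands for the focus itself, so that a fan whose list contains
    [0] has a focus of a color different from those of its other members. *)
Definition is_fan (C : eqType) (chi : nat -> C) (k N f : nat) (ds : seq nat) :=
  [/\ (f < N)%N, uniq [seq chi (f + d)%N | d <- ds] &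
    forall d, d \in ds -> (f + d * k.+1 < N)%N /\
      forall i, (i <= k)%N -> chi (f + d * i.+1)%N = chi (f + d)%N].

Lemma mono_ap_shift (C : Type) (chi : nat -> C) (k M N x : nat) :
  (x + M <= N)%N -> mono_ap (fun y => chi (x + y)%N) k M -> mono_ap chi k N.
Proof.
move=> leN [a [d [d0 dM da]]]; exists (x + a)%N, d; split=> //.
  by rewrite -addnA (leq_trans _ leN) // ltn_add2l.
by move=> i ik; rewrite -addnA da.
Qed.

(** Cut the naturals into blocks of length [M] and color each block by its
    whole pattern.  When the blocks [b + D], ..., [b + D * k.+1] have the same
    pattern, a fan of the first of them recurs in the others; adding [D * M] to
    each of its differences moves along from block to block, so that the fan now
    aims at the point [g] which sits in block [b] as the old focus sits in its
    block.  If [g] has a new color, it enters the fan with the difference [0];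
    otherwise it prolongs one of the progressions. *)
Lemma fan_step (C : finType) (chi : nat -> C) (k s M N : nat) :
  (forall phi : nat -> C, mono_ap phi k.+1 M \/
     exists f ds, size ds = s /\ is_fan phi k M f ds) ->
  pre_mono_ap (fun j => [ffun x : 'I_M => chi (j * M + x)%N]) k N ->
  mono_ap chi k.+1 (N * M) \/
  exists f ds, size ds = s.+1 /\ is_fan chi k (N * M) f ds.
Proof.
move=> fanM [b [D [D0 bDN same_block]]].
have copy i x : (i <= k)%N -> (x < M)%N ->
    chi ((b + D * i.+1) * M + x)%N = chi ((b + D) * M + x)%N.
  move=> ik xM; have /ffunP/(_ (Ordinal xM)) := same_block i ik.
  by rewrite !ffunE.
have blockN y x : (y <= b + D * k.+1)%N -> (x < M)%N -> (y * M + x < N * M)%N.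
  by move=> yb xM; apply: (@leq_trans (y.+1 * M)); [lia | rewrite leq_mul2r; lia].
have [ap|[f [ds [size_ds [fM uniq_ds fan_ds]]]]] :=
    fanM (fun x => chi ((b + D) * M + x)%N).
  left; apply: mono_ap_shift ap.
  by rewrite -mulSnr leq_mul2r; apply/orP; right; nia.
pose g := (b * M + f)%N; pose ds' := [seq (D * M + d)%N | d <- ds].
have g_step d i : (g + (D * M + d) * i.+1)%N =
    ((b + D * i.+1) * M + (f + d * i.+1))%N by rewrite /g; nia.
have fan_ds' d : d \in ds' -> (g + d * k.+1 < N * M)%N /\
    forall i, (i <= k)%N -> chi (g + d * i.+1)%N = chi (g + d)%N.
  move=> /mapP[e /fan_ds[eM e_mono] ->]; split; first by rewrite g_step blockN.
  have e_lt i : (i <= k)%N -> (f + e * i.+1 < M)%N.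
    move=> ik; apply: leq_ltn_trans eM.
    by rewrite leq_add2l leq_mul2l ltnS ik orbT.
  move=> i ik; rewrite g_step copy ?e_lt// e_mono//.
  by congr chi; rewrite /g; nia.
have colors_ds' : [seq chi (g + d)%N | d <- ds'] =
    [seq chi ((b + D) * M + (f + d))%N | d <- ds].
  by rewrite -map_comp; apply: eq_map => d /=; congr chi; rewrite /g; nia.
have [/mapP[d d_ds' gd]|g_new] :=
    boolP (chi g \in [seq chi (g + d)%N | d <- ds']).
  left; exists g, d; have [dN d_mono] := fan_ds' d d_ds'; split=> //.
    have /mapP[e _ ->] := d_ds'; rewrite addn_gt0 muln_gt0 D0/=.
    by rewrite (leq_ltn_trans _ fM).
  by case=> [|i] ik; rewrite ?muln0 ?addn0// d_mono.
right; exists g, (0%N :: ds'); split; first by rewrite /= size_map size_ds.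
have gN : (g < N * M)%N by rewrite blockN// leq_addr.
split=> //.
  by rewrite /= addn0 g_new colors_ds'.
move=> d; rewrite inE => /predU1P[->|/fan_ds'//].
by rewrite mul0n addn0; split=> // i _; rewrite mul0n addn0.
Qed.

Lemma fan_or_ap (C : finType) (k s : nat) :
  (forall B : finType, exists N, forall chi : nat -> B, pre_mono_ap chi k N) ->
  exists M, forall chi : nat -> C, mono_ap chi k.+1 M \/
    exists f ds, size ds = s /\ is_fan chi k M f ds.
Proof.
move=> vdW; elim: s => [|s [M fanM]].
  by exists 1%N => chi; right; exists 0%N, [::].
have [N vdWN] := vdW {ffun 'I_M -> C}.
by exists (N * M)%N => chi; apply: fan_step.
Qed.

Lemma fan_size (C : finType) (chi : nat -> C) (k N f : nat) (ds : seq nat) :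
  is_fan chi k N f ds -> (size ds <= #|C|)%N.
Proof.
by case=> _ /card_uniqP + _; rewrite size_map => <-; apply: max_card.
Qed.

(** A window of length [M] that starts at [M] leaves room for the point that
    precedes the progression. *)
Lemma pre_mono_ap_of_mono (C : Type) (chi : nat -> C) (k M : nat) :
  mono_ap (fun x => chi (M + x)%N) k.+1 M -> pre_mono_ap chi k.+1 (M + M).
Proof.
move=> [a [d [d0 adM da]]].
have shift i : (M + a - d + d * i.+1 = M + (a + d * i))%N by nia.
exists (M + a - d)%N, d; split=> //; first by rewrite shift ltn_add2l.
by have := shift 0%N; rewrite muln1 muln0 addn0 => -> i ik; rewrite shift da.
Qed.

Theorem van_der_waerden (k : nat) (C : finType) :
  exists N, forall chi : nat -> C, pre_mono_ap chi k N.
Proof.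
elim: k C => [|k IHk] C.
  by exists 2%N => chi; exists 0%N, 1%N; split=> // -[].
have [M fanM] := fan_or_ap C #|C|.+1 IHk.
exists (M + M)%N => chi; apply: pre_mono_ap_of_mono.
have [//|[f [ds [size_ds /fan_size]]]] := fanM (fun x => chi (M + x)%N).
by rewrite size_ds ltnn.
Qed.

(** * Ladders *)

Lemma posint_ladder : is_ladder posint.
Proof.
split=> // r chi k.
have [N /(_ (chi \o Posz))[a [d [d0 _ da]]]] := van_der_waerden k 'I_r.
exists (a + d)%N%:Z, d%:Z; split; first exact: d0.
exists (chi (a + d)%N%:Z) => i /ltnW/da /= <-; congr chi; lia.
Qed.

(** Failure of the ladder property is witnessed by one coloring and one length.
    If neither [A] nor [B] is a ladder, a progression for the product of the two
    colorings, of the larger length, is monochromatic for both of them, while its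
    difference lies in [A] or in [B]. *)
Lemma ladder_setU (A B : set int) :
  is_ladder (A `|` B) -> is_ladder A \/ is_ladder B.
Proof.
move=> [AB_pos AB_ap]; apply: contrapT => /not_orP[nA nB].
have bad (T : set int) : T `<=` A `|` B -> ~ is_ladder T ->
    exists r (chi : int -> 'I_r) k, forall a d, T d ->
      ~ exists c, forall i, (i < k)%N -> chi (a + d *+ i) = c.
  move=> sT nT; apply: contrapT => no_bad; apply: nT; split.
    exact: subset_trans AB_pos.
  move=> r chi k; apply: contrapT => no_ap; apply: no_bad.
  by exists r, chi, k => a d Td ap; apply: no_ap; exists a, d.
have [r [chi [k chi_bad]]] := bad A (@subsetUl _ A B) nA.
have [s [psi [l psi_bad]]] := bad B (@subsetUr _ A B) nB.
have [a [d [ABd [c ap]]]] :=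
  AB_ap _ (fun x => enum_rank (chi x, psi x)) (maxn k l).
have both i : (i < maxn k l)%N ->
    (chi (a + d *+ i), psi (a + d *+ i)) = enum_val c.
  by move=> /ap <-; rewrite enum_rankK.
case: ABd => [Ad|Bd].
  apply: (chi_bad a d Ad); exists (enum_val c).1 => i ik.
  by rewrite -(both i)// leq_max ik.
apply: (psi_bad a d Bd); exists (enum_val c).2 => i il.
by rewrite -(both i)// leq_max il orbT.
Qed.

(** * Splitting countably many infinite sets *)

(** Enumerate the requests [(i, b)] and serve each of them by a point of [F i]
    that was not used before: [S] consists of the points that serve requests
    [(i, true)], and those that serve requests [(i, false)] stay outside. *)
Lemma splitting_set (I : countType) (T : choiceType) (F : I -> set T) :
  exists S : set T, forall i, infinite_set (F i) ->
    (exists x, F i x /\ S x) /\ (exists x, F i x /\ ~ S x).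
Proof.
have [[x0]|noT] := pselect (inhabited T); last first.
  exists set0 => i Fi; have [x _] := infinite_setN0 Fi.
  by case: (noT (inhabits x)).
pose G n : set T :=
  if (unpickle n : option (I * bool)) is Some (i, _) then F i else set0.
pose fresh n (s : seq T) := xget x0 (G n `\` [set` s]).
pose used := fix used n :=
    if n is m.+1 then fresh m (used m) :: used m else [::].
pose e (ib : I * bool) := fresh (pickle ib) (used (pickle ib)).
have eP i b : infinite_set (F i) ->
    F i (e (i, b)) /\ e (i, b) \notin used (pickle (i, b)).
  move=> Fi.
  have fin_used := finite_seq (used (pickle (i, b))).
  have [x Fx] := infinite_setN0 (infinite_setD Fi fin_used).
  rewrite /e /fresh.
  case: xgetP => [y _ []|/(_ x)]; rewrite /G pickleK; last by move=> /(_ Fx).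
  by move=> Fy /negP.
have usedP n m : (m < n)%N -> fresh m (used m) \in used n.
  elim: n => // n IHn; rewrite ltnS leq_eqVlt inE => /predU1P[->|/IHn ->].
    by rewrite eqxx.
  by rewrite orbT.
have e_sep i j : infinite_set (F i) -> infinite_set (F j) ->
    e (i, true) <> e (j, false).
  move=> Fi Fj eij; have [_ ni] := eP i true Fi; have [_ nj] := eP j false Fj.
  case: (ltngtP (pickle (i, true)) (pickle (j, false))) => [lt_ij|lt_ji|].
  - by move/negP: nj; apply; rewrite -eij; apply: usedP.
  - by move/negP: ni; apply; rewrite eij; apply: usedP.
  - by move/(pcan_inj pickleK).
exists [set x | exists2 i, infinite_set (F i) & x = e (i, true)] => i Fi; split.
  by exists (e (i, true)); split; [have [] := eP i true Fi | exists i].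
exists (e (i, false)); split; first by have [] := eP i false Fi.
by move=> [j Fj /esym]; apply: e_sep.
Qed.

Lemma infinite_pos_values_size (P : {poly int}) :
  infinite_set (pos_values P) -> (1 < size P)%N.
Proof.
move=> infP; rewrite ltnNge; apply/negP => /size1_polyC PC; apply: infP.
apply: (@sub_finite_set _ _ [set P`_0]); last exact: finite_set1.
by move=> _ [[n _ <-] _]; rewrite /= PC hornerC coefC.
Qed.

Theorem mainTheorem1 :
  (exists S : set int,
    [/\ S `<=` posint,
        forall P : {poly int}, (1 < size P)%N -> infinite_set (pos_values P) ->
          (exists n, pos_values P n /\ S n) /\
          (exists n, pos_values P n /\ ~ S n),
        forall P : {poly int}, infinite_set (pos_values P) ->
          ~ (pos_values P `<=` S) /\ ~ (pos_values P `<=` posint `\` S)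
      & is_ladder S \/ is_ladder (posint `\` S)]) /\
  ~ (forall T : set int, is_ladder T ->
       exists P : {poly int},
         [/\ P.[0] = 0, infinite_set (pos_values P) & pos_values P `<=` T]).
Proof.
have [S0 split_S0] := splitting_set pos_values.
pose S := S0 `&` posint.
have split_S P : infinite_set (pos_values P) ->
    (exists n, pos_values P n /\ S n) /\ (exists n, pos_values P n /\ ~ S n).
  move=> /split_S0[[x [Px Sx]] [y [Py Sy]]]; split.
    by exists x; split=> //; split=> //; have [] := Px.
  by exists y; split=> // -[].
have no_values P : infinite_set (pos_values P) ->
    ~ (pos_values P `<=` S) /\ ~ (pos_values P `<=` posint `\` S).
  move=> /split_S[[x [Px Sx]] [y [Py Sy]]]; split=> sub.
    exact/Sy/sub.
  by have [] := sub x Px.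
have S_pos : S `<=` posint by move=> x [].
have ladder_S : is_ladder S \/ is_ladder (posint `\` S).
  by apply: ladder_setU; rewrite setDUK//; exact: posint_ladder.
split.
  by exists S; split=> // P _; apply: split_S.
by move=> conv; case: ladder_S => /conv[P [_ /no_values[]]].
Qed.
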